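(* Let $f$ be a canonical function whose bounded density shift $X_f$ has limiting gradient $\alpha_f>0$. Then $X_f$ is entropy minimal.
   Context: A function $f:\mathbb{N}_0\to[0,\infty)$ is canonical if $f(0)=0$, $f(k+1)\ge f(k)$ for all $k\ge 0$, and $f(k+n)\le f(k)+f(n)$ for all $k,n\in\mathbb{N}$. The bounded density shift associated to a canonical function $f$ is $$X_f=\Big\{x\in(\mathbb{N}_0)^{\mathbb{Z}}:\ \forall p\in\mathbb{N},\ \forall i\in\mathbb{Z},\ \sum_{r=i}^{i+p-1}x_r\le f(p)\Big\},$$ which is a subshift (closed, shift-invariant set) over the alphabet $\{0,1,\dots,\lfloor f(1)\rfloor\}$, with the shift map $\sigma$ given by $(\sigma x)_i=x_{i+1}$. The limiting gradient of $X_f$ is $\alpha_f=\lim_{n\to\infty} f(n)/n$ (the limit exists and equals the infimum, by subadditivity). For a subshift $X$, $\mathcal{L}_n(X)$ is the set of words of length $n$ appearing in points of $X$ and $h_{top}(X)=\lim_{n\to\infty}\frac1n\log|\mathcal{L}_n(X)|$ is its topological entropy. A subshift $X$ is entropy minimal if every (nonempty) subshift strictly contained in $X$ has strictly lower topological entropy than $X$; equivalently, if every measure of maximal entropy of $X$ (a $\sigma$-invariant Borel probability measure $\mu$ on $X$ with $h_\mu(X)=h_{top}(X)$) is fully supported, i.e. gives positive measure to every nonempty open subset of $X$. *)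

(* Defs.v *)
From HB Require Import structures.
From mathcomp Require Import all_boot all_order all_algebra finmap.
From mathcomp Require Import all_classical all_reals all_analysis.

Set Implicit Arguments.
Unset Strict Implicit.
Unset Printing Implicit Defensive.

Import Order.TTheory GRing.Theory Num.Theory.
Import numFieldNormedType.Exports.

Local Open Scope classical_set_scope.
Local Open Scope ring_scope.

(* `{ptws int -> nat}` is `int -> nat` with the product topology, each factor
   `nat` being discrete. *)
Definition config := {ptws int -> nat}.

Definition shift (x : config) : config := fun i : int => x (i + 1).

(* Closed shift-invariant sets over a finite alphabet {0, ..., m}.  The empty
   set is included; nonemptiness is required where it is needed. *)
Definition subshift (X : set config) : Prop :=
  [/\ closed X, shift @` X = X &
      exists m : nat, forall x : config, X x -> forall i, (x i <= m)%N].

Definition language (X : set config) (n : nat) : set (n.-tuple nat) :=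
  [set w | exists x : config, X x /\
           exists i : int, forall k : 'I_n, tnth w k = x (i + k%:Z)].
Arguments language : clear implicits.

(* `fset_set` and `lim` return default values on infinite sets and divergent
   sequences.  For a nonempty subshift, the languages are finite and nonempty
   and the limit exists by subadditivity.  The term n = 0 is irrelevant. *)
Definition htop (R : realType) (X : set config) : R :=
  lim ((fun n : nat =>
          ln (#|` fset_set (language X n)|%fset%:R : R) / n%:R) @ \oo).

Definition entropy_minimal (R : realType) (X : set config) : Prop :=
  subshift X /\
  forall Y : set config,
    subshift Y -> Y !=set0 -> Y `<` X -> htop R Y < htop R X.

Definition canonical_fun (R : realType) (f : nat -> R) : Prop :=
  [/\ forall k, 0 <= f k,
      f 0%N = 0,
      forall k, f k <= f k.+1 &
      forall k n, (0 < k)%N -> (0 < n)%N -> f (k + n)%N <= f k + f n].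

Definition bounded_density_shift (R : realType) (f : nat -> R) : set config :=
  [set x | forall p : nat, (0 < p)%N -> forall i : int,
           ((\sum_(r < p) x (i + r%:Z)%R)%N%:R : R) <= f p].

(* The limit exists for canonical `f`, by subadditivity. *)
Definition limiting_gradient (R : realType) (f : nat -> R) : R :=
  lim ((fun n : nat => f n / n%:R) @ \oo).

(* Main.v *)
Require Import Defs.
From mathcomp Require Import all_boot all_order all_algebra finmap.
From mathcomp Require Import all_classical all_reals all_analysis.
From mathcomp Require Import zify ring lra.

Set Implicit Arguments.
Unset Strict Implicit.
Unset Printing Implicit Defensive.

Import Order.TTheory GRing.Theory Num.Theory.
Import numFieldNormedType.Exports.

(** Write [X] for the bounded density shift and let [Y] be a nonempty subshift
strictly inside [X].  Since [Y] is closed and shift-invariant, some word [w] of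
a point of [X] never occurs in [Y] (missing_word).  The proof plants copies of
[w] in the words of [Y] and counts the words of [X] so obtained.

Planting.  Take [x] in [X], a stretch [A] of positions followed by a stretch
[W] of length [|w|] and a stretch [C], such that the sum of [x] over [A] and its
sum over [C] are both at least the sum of [w].  Replacing [x] by [w] on [W] and
by zeros on [A] and [C] gives a point of [X] (bounded_density_overwrite): a
window that meets [W] either stays inside the three stretches, where only a part
of [w] is seen, or contains one of [A], [C] entirely, and then loses at least as
much as the copy of [w] can add.

Counting.  Cut words into blocks of a fixed length [L] and call a block good if
it has room for such a replacement.  Any set of good blocks of a word of [Y] can
be replaced simultaneously.  As [w] does not occur in [Y], the replaced blocks
are exactly those that contain [w]; so only the former contents of the replaced
blocks are lost, one of [D] possibilities for each.  Keeping that content as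
extra data, every good block of a word of [Y] yields [D + 1] alternatives where
[X] has only [D] (weighted_rewriting).  Hence the words of [Y] with more than [j]
good blocks are fewer than those of [X] by a factor [(D / (D + 1)) ^ j].

The other words of [Y] are negligible.  A block that is not good has a sum
bounded independently of [L] (bad_block_sum), so there are only polynomially
many of them in [L] (card_bad_blocks), whereas [X] has exponentially many words.
This growth is where the positive limiting gradient enters: if [f 1 >= 1], then
[X] contains, for some period [N0], the indicator of the multiples of [N0]
(comb_mem) and every configuration below it.  If [f 1 < 1], then [X] is a single
fixed point and has no proper nonempty subshift.

Comparing the two counts (rewriting_gain, word_count_gap) gives
[#Y_n (D + 1) ^ j <= 2 #X_n D ^ j] for words of length [n = c j], that is, a gap
of the exponential growth rates.  Both entropies are genuine limits by Fekete's
lemma (subadditive_mean_cvg), so they can be compared along the multiples of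
[c] (htop_lt). *)

(** * Rewriting good blocks *)

Section BlockCount.
Variables (B : finType) (N : nat) (good : pred B).
Local Notation D := #|B|.
Local Notation word := {ffun 'I_N -> B}.

Definition good_blocks (u : word) : nat := #|[pred j | good (u j)]|.

Definition rewrite_blocks (T : B -> B) (S : {set 'I_N}) (u : word) : word :=
  [ffun j => if j \in S then T (u j) else u j].

Lemma prod_good_blocks (u : word) (a b : nat) :
  (\prod_j (if good (u j) then a else b) = a ^ good_blocks u * b ^ (N - good_blocks u))%N.
Proof.
rewrite (bigID (fun j => good (u j))) /=; congr (_ * _)%N.
  by rewrite (eq_bigr (fun=> a)) => [|j ->//]; rewrite prod_nat_const.
rewrite (eq_bigr (fun=> b)) => [|j /negbTE ->//]; rewrite prod_nat_const.
congr (_ ^ _)%N; have := cardC [pred j | good (u j)]; rewrite card_ord.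
rewrite -/(good_blocks u) => /(congr1 (subn^~ (good_blocks u))) /=.
by rewrite addKn => <-; apply: eq_card.
Qed.

(** An injection.  Attach a spare block to every position of a word [u] of [Y].
At a good position one may keep the block of [u] and fill the spare arbitrarily,
in [D] ways, or rewrite the block and store its former content in the spare, in
one way; elsewhere only the first option is open.  The outcome is a word of [X]
with [N] spare blocks, and it determines everything: the rewritten positions are
the marked ones, and there the spare returns the block of [u]. *)
Lemma weighted_rewriting (marked : pred B) (T : B -> B) (Y X : {set word}) :
    (forall u (S : {set 'I_N}), u \in Y -> (forall j, j \in S -> good (u j)) ->
       rewrite_blocks T S u \in X) ->
    (forall u j, u \in Y -> ~~ marked (u j)) ->
    (forall b, good b -> marked (T b)) ->
  (\sum_(u in Y) \prod_j (if good (u j) then D.+1 else D) <= #|X| * D ^ N)%N.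
Proof.
move=> TX Ymark Tmark.
pose allowed (u : word) (phi : {ffun 'I_N -> option B}) :=
  [forall j, (phi j == None) ==> good (u j)].
have prodE (u : word) : (\prod_j (if good (u j) then D.+1 else D) =
    \sum_(phi : {ffun 'I_N -> option B}) allowed u phi)%N.
  (* [None] stands for rewriting, [Some c] for keeping the block with spare [c] *)
  pose F j (c : option B) : nat := (c == None) ==> good (u j).
  transitivity (\prod_j \sum_c F j c)%N.
    apply: eq_bigr => j _; rewrite (bigD1 None) //= {1}/F eqxx /=.
    rewrite (eq_bigr (fun=> 1%N)) => [|[b|] //]; rewrite sum1_card.
    have -> : #|[pred c : option B | c != None]| = D.
      have := cardC (pred1 (None : option B)).
      by rewrite card1 card_option add1n => -[<-]; apply: eq_card.
    by case: (good _).
  rewrite bigA_distr_bigA /=; apply: eq_bigr => phi _.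
  have [/forallP h|/forallPn[j hj]] := boolP (allowed u phi).
    by rewrite big1 // => j _; rewrite /F h.
  by rewrite (bigD1 j) //= /F (negbTE hj).
rewrite (eq_bigr _ (fun u _ => prodE u)) pair_big_dep /=.
pose Z := [set p : word * {ffun 'I_N -> option B} | (p.1 \in Y) && allowed p.1 p.2].
have -> : (\sum_(p | (p.1 \in Y) && true) allowed p.1 p.2 = #|Z|)%N.
  rewrite -sum1_card big_mkcond [RHS]big_mkcond; apply: eq_bigr => p _.
  by rewrite inE andbT; case: (p.1 \in Y); case: (allowed _ _).
pose S (phi : {ffun 'I_N -> option B}) := [set j | phi j == None].
pose G (p : word * {ffun 'I_N -> option B}) : word * word :=
  (rewrite_blocks T (S p.2) p.1, [ffun j => odflt (p.1 j) (p.2 j)]).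
have -> : (#|X| * D ^ N = #|finset.setX X [set: word]|)%N.
  by rewrite cardsX cardsT card_ffun card_ord.
have GX p : p \in Z -> G p \in finset.setX X [set: word].
  rewrite !inE andbT => /andP[pY /forallP ph]; apply: TX => // j.
  by rewrite inE => pj; have := ph j; rewrite pj.
have markS p j : p \in Z -> marked ((G p).1 j) = (j \in S p.2).
  rewrite inE => /andP[pY /forallP ph]; rewrite ffunE.
  case: ifPn => [|_]; last exact/negbTE/Ymark.
  by rewrite inE => pj; apply: Tmark; have := ph j; rewrite pj.
have GI : {in Z &, injective G}.
  move=> [u phi] [u' phi'] Zp Zp' GG.
  have SS j : (phi j == None) = (phi' j == None).
    by have := markS _ j Zp; have := markS _ j Zp'; rewrite GG !inE /= => -> ->.
  case: GG => /ffunP Gu /ffunP Gphi.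
  congr pair; apply/ffunP => j; have := SS j; have := Gu j; have := Gphi j; rewrite !ffunE !inE /=;
    by case: (phi j) => [b|]; case: (phi' j) => [b'|] //= e1 e2 _; rewrite ?e1 ?e2.
rewrite -(card_in_imset GI); apply: subset_leq_card; apply/fintype.subsetP => _ /imsetP[p Zp ->].
exact: GX.
Qed.

(** Give a word the weight [D ^ g], with [g] the number of its blocks that are not good.
The total weight over all words factors over the positions and is at most
[(D + D * b) ^ N] with [b] the number of blocks that are not good, while each of
the words counted here has weight at least [D ^ (N - k)]. *)
Lemma few_good_blocks (k : nat) : (0 < D)%N -> (k <= N)%N ->
  (#|[set u : word | (good_blocks u <= k)%N]| <= D ^ k * #|[pred b | ~~ good b]|.+1 ^ N)%N.
Proof.
move=> D0 kN; set b := #|[pred b | ~~ good b]|.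
have DNk : (0 < D ^ (N - k))%N by rewrite expn_gt0 D0.
rewrite -(leq_pmul2r DNk) mulnAC -expnD subnKC // -expnMn.
have sumE : (\sum_(u : word) \prod_j (if good (u j) then 1 else D) <= (D * b.+1) ^ N)%N.
  rewrite -(bigA_distr_bigA (fun (_ : 'I_N) (c : B) => if good c then 1 else D)%N) /=.
  rewrite prod_nat_const card_ord; case: (posnP N) => [->//|N0].
  rewrite leq_exp2r // (bigID good) /= (eq_bigr (fun=> 1%N)) => [|c ->//].
  rewrite sum1_card (eq_bigr (fun=> D)) => [|c /negbTE ->//].
  rewrite sum_nat_const -/b mulnS mulnC leq_add //.
  exact: max_card.
apply: leq_trans sumE.
rewrite -sum_nat_const big_mkcond /=; apply: leq_sum => u _.
case: ifP => //; rewrite inE => uk; rewrite prod_good_blocks exp1n mul1n.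
by rewrite leq_pexp2l // leq_sub2l.
Qed.

(** A word of [Y] either has more than [k] good blocks, and then the rewriting
gains [(D + 1) / D] at least [k] times, or it is one of at most [F ^ k] words, a
negligible number next to the [F ^ (2 k)] words of [X]: as [D + 1 <= F D], the
same bound holds for both kinds, whence the factor [2]. *)
Lemma rewriting_gain (marked : pred B) (T : B -> B) (Y X : {set word}) (k q F : nat) :
    (0 < D)%N -> (0 < q)%N -> (2 <= F)%N -> N = (k * q)%N ->
    (forall u (S : {set 'I_N}), u \in Y -> (forall j, j \in S -> good (u j)) ->
       rewrite_blocks T S u \in X) ->
    (forall u j, u \in Y -> ~~ marked (u j)) ->
    (forall b, good b -> marked (T b)) ->
    (D * #|[pred b | ~~ good b]|.+1 ^ q <= F)%N -> (F ^ (2 * k) <= #|X|)%N ->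
  (#|Y| * D.+1 ^ k <= 2 * #|X| * D ^ k)%N.
Proof.
move=> D0 q0 F2 Nkq TX Ymark Tmark DF FX.
have kN : (k <= N)%N by rewrite Nkq leq_pmulr.
pose few := [set u : word | (good_blocks u <= k)%N].
have rich : (#|Y :\: few| * D.+1 ^ k <= #|X| * D ^ k)%N.
  have DNk : (0 < D ^ (N - k))%N by rewrite expn_gt0 D0.
  rewrite -(leq_pmul2r DNk) -!mulnA -expnD subnKC //.
  apply: leq_trans (weighted_rewriting TX Ymark Tmark).
  rewrite -sum_nat_const big_mkcond [leqRHS]big_mkcond /=; apply: leq_sum => u _.
  rewrite !inE -ltnNge; case: ifP => // /andP[ku ->].
  rewrite prod_good_blocks.
  have gN : (good_blocks u <= N)%N by rewrite -[leqRHS]card_ord max_card.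
  rewrite -(subnKC (ltnW ku)) expnD -mulnA leq_mul2l; apply/orP; right.
  rewrite (_ : N - k = good_blocks u - k + (N - good_blocks u))%N; last by lia.
  rewrite (subnKC (ltnW ku)) expnD leq_mul2r; apply/orP; right.
  case: (posnP (good_blocks u - k)) => [->//|g0].
  by rewrite leq_exp2r.
have poor : (#|Y :&: few| * D.+1 ^ k <= #|X| * D ^ k)%N.
  have fewF : (#|Y :&: few| <= F ^ k)%N.
    apply: leq_trans (subset_leq_card (finset.subsetIr _ _)) _.
    apply: leq_trans (few_good_blocks D0 kN) _.
    rewrite Nkq mulnC (mulnC k) expnM -expnMn mulnC.
    by case: (posnP k) => [->//|k0]; rewrite leq_exp2r.
  have DF2 : (D.+1 ^ k <= F ^ k * D ^ k)%N.
    rewrite -expnMn; case: (posnP k) => [->//|k0]; rewrite leq_exp2r //.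
    by apply: leq_trans (leq_mul F2 (leqnn D)); lia.
  apply: leq_trans (leq_mul fewF DF2) _.
  by rewrite mulnA leq_mul2r -expnD addnn -mul2n FX orbT.
rewrite -(cardsID few Y) mulnDl mul2n -addnn mulnDl addnC.
exact: leq_add.
Qed.

End BlockCount.

(** * Few blocks have a small sum *)

Lemma exists_exp_dominates (c s : nat) :
  exists2 l, (0 < l)%N & ((c * l).+1 ^ s < 2 ^ l)%N.
Proof.
(* [l] is chosen as a power [2 ^ (2 * r)]: then [c * l + 2 <= 2 ^ (c + 2 + 2 * r)],
   and the exponent only grows linearly in [r] whereas [l >= r ^ 2] *)
pose r := (c + 2 + 3 * s.+1)%N.
pose l := (2 ^ (2 * r))%N.
have l0 : (0 < l)%N by rewrite expn_gt0.
exists l => //.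
have rl : ((c + 2 + 2 * r) * s.+1 <= l)%N.
  have : (r * r <= l)%N.
    by rewrite /l mul2n -addnn expnD leq_mul // ltnW // ltn_expl.
  have : (3 * s.+1 <= r)%N by rewrite leq_addl.
  have : (c + 2 <= r)%N by rewrite leq_addr.
  by nia.
have xl : (c * l + 2 <= 2 ^ (c + 2 + 2 * r))%N.
  rewrite expnD -/l; apply: (@leq_trans ((c + 2) * l)%N); first by nia.
  by rewrite leq_mul2r ltnW ?orbT // ltn_expl.
apply: leq_trans (_ : 2 ^ ((c + 2 + 2 * r) * s.+1) <= _)%N; last by rewrite leq_exp2l.
rewrite expnM; apply: leq_trans (_ : (c * l + 2) ^ s.+1 <= _)%N; last by rewrite leq_exp2r.
apply: leq_ltn_trans (_ : (c * l + 2) ^ s < _)%N; last by rewrite ltn_exp2l // addn2.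
case: (posnP s) => [->|s0]; first by rewrite expn0 addn2.
by rewrite leq_exp2r ?addn2.
Qed.

(** Independently of the alphabet: a nonzero sequence comes from one of smaller
sum by raising one of its [L] entries by one, so each unit of the sum costs a
factor [L + 1] only. *)
Lemma card_small_sum (L M s : nat) :
  (#|[set b : {ffun 'I_L -> 'I_M.+1} | (\sum_i b i <= s)%N]| <= L.+1 ^ s)%N.
Proof.
elim: s => [|s IH].
  rewrite expn0; apply/card_le1_eqP => b b'; rewrite !inE !leqn0 !sum_nat_eq0.
  move=> /forallP b0 /forallP b0'; apply/ffunP => i; apply/val_inj.
  move: (b0 i) (b0' i) => /= /eqP e /eqP e'.
  by rewrite e e'.
pose E := [set b : {ffun 'I_L -> 'I_M.+1} | (\sum_i b i <= s)%N].
pose incr (p : option 'I_L * {ffun 'I_L -> 'I_M.+1}) : {ffun 'I_L -> 'I_M.+1} :=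
  [ffun i => if p.1 == Some i then inord (p.2 i).+1 else p.2 i].
rewrite expnS; apply: leq_trans (leq_mul (leqnn _) IH).
have -> : (L.+1 * #|E| = #|finset.setX [set: option 'I_L] E|)%N.
  by rewrite cardsX cardsT card_option card_ord.
apply: leq_trans (leq_imset_card incr _).
apply: subset_leq_card; apply/fintype.subsetP => u; rewrite inE leq_eqVlt ltnS.
case/orP => [/eqP us|us]; last first.
  by apply/imsetP; exists (None, u); rewrite ?inE //; apply/ffunP => i; rewrite !ffunE.
have [k uk] : exists k, (0 < u k)%N.
  apply/existsP; apply: contraTT isT => /existsPn u0.
  by move: us; rewrite big1 // => i _; apply/eqP; rewrite -leqn0 leqNgt u0.
pose u' : {ffun 'I_L -> 'I_M.+1} := [ffun i => if i == k then inord (u k).-1 else u i].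
have u'k : u' k = (u k).-1 :> nat.
  by rewrite ffunE eqxx inordK // (leq_ltn_trans (leq_pred _)).
apply/imsetP; exists (Some k, u').
  rewrite !inE /= -ltnS -us (bigD1 k) //= u'k [in leqRHS](bigD1 k) //=.
  rewrite (eq_bigr (fun i => u i : nat)) => [|i /negbTE ik]; last by rewrite ffunE ik.
  by rewrite ltn_add2r prednK.
apply/ffunP => i; rewrite [RHS]ffunE /=; apply/val_inj.
have [/eqP[<-]|ki] := ifPn; first by rewrite u'k prednK // inord_val.
by rewrite ffunE ifN //; apply: contraNneq ki => ->.
Qed.

Local Open Scope classical_set_scope.
Local Open Scope ring_scope.

(** * Closed shift-invariant sets *)

Lemma nbhs_coordinate (x : config) (i : int) : nbhs x [set y : config | y i = x i].
Proof.
have := @proj_continuous int (fun _ => nat) i x [set x i].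
by apply; exact: discrete_set1.
Qed.

Lemma cvg_config (y : nat -> config) (x : config) :
  (forall i, \forall n \near \oo, y n i = x i) -> y @ \oo --> x.
Proof.
move=> h; apply/cvg_sup => i; apply/cvg_image.
  by rewrite eqEsubset; split=> v // _; exists (fun=> v).
move=> W /= Wx; rewrite nbhs_simpl /=.
exists (@^~ i @^-1` W).
  rewrite /=; near=> n.
  rewrite /=; have -> : y n i = x i by near: n.
  exact: nbhs_singleton.
by rewrite eqEsubset; split => [j [? + <-//]|j Wj]; exists (fun _ => j).
Unshelve. all: by end_near.
Qed.

Lemma subshift_translate (X : set config) (x : config) (c : int) :
  subshift X -> X x -> X (fun i => x (i + c)).
Proof.
move=> [_ shX _].
have fwd y : X y -> X (fun i => y (i + 1)).
  by move=> Xy; rewrite -shX; exists y.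
have bwd y : X y -> X (fun i => y (i - 1)).
  rewrite -{1}shX => -[z Xz <-]; rewrite (_ : (fun i => _) = z) //.
  by apply/funext => i; rewrite /shift /=; congr z; lia.
move=> Xx; have posc n : X (fun i => x (i + n%:Z)) /\ X (fun i => x (i - n%:Z)).
  elim: n => [|n [IHp IHn]].
    by split; rewrite (_ : (fun i => _) = x) //; apply/funext => i; congr x; lia.
  split.
    rewrite (_ : (fun i => _) = fun i => x (i + 1 + n%:Z)); first exact: fwd IHp.
    by apply/funext => i; congr x; lia.
  rewrite (_ : (fun i => _) = fun i => x (i - 1 - n%:Z)); first exact: bwd IHn.
  by apply/funext => i; congr x; lia.
case: (intP c) => [|n|n]; [have [] := posc 0%N|have [] := posc n.+1|have [_] := posc n.+1] => //.
Qed.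

(** If every word of [x] around the origin occurred in [Y], then translates of
points of [Y] would agree with [x] on larger and larger windows and converge to
[x], which would lie in the closed set [Y]. *)
Lemma missing_word (Y : set config) (x : config) :
    subshift Y -> ~ Y x ->
  exists (k : nat) (a : int), forall (y : config) (c : int), Y y ->
    ~ (forall r : nat, (r < k)%N -> y (c + r%:Z) = x (a + r%:Z)).
Proof.
move=> sY nYx; apply: contra_notP nYx => /forallNP noword.
have approx n : exists y, Y y /\ forall i : int, `|i| <= n%:Z -> y i = x i.
  have := noword n.*2.+1 => /forallNP /(_ (- n%:Z)) /existsNP [y] /existsNP [c].
  move=> /not_implyP [Yy /contrapT yx].
  exists (fun i => y (i + (c + n%:Z))); split; first exact: (subshift_translate _ sY Yy).
  move=> i ni; have := yx (absz (i + n%:Z)).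
  have -> : (absz (i + n%:Z)%R < n.*2.+1)%N by lia.
  move=> /(_ isT); have -> : (absz (i + n%:Z))%:Z = i + n%:Z by lia.
  rewrite (_ : c + _ = i + (c + n%:Z)); last by lia.
  by move=> ->; congr x; lia.
have [y yP] := choice approx.
have [clY _ _] := sY.
apply: (@closed_cvg nat config \oo _ y Y clY _ x _).
  by exists 0%N => // n _; have [] := yP n.
apply: cvg_config => i; near=> n; have [_] := yP n; apply.
have : (absz i <= n)%N by near: n; exact: nbhs_infty_ge.
by lia.
Unshelve. all: by end_near.
Qed.

(** * Planting a word in a point of a bounded density shift *)

(** Brings sums over different windows to a common index range, where they can
be compared term by term. *)
Lemma window_sum_enlarge (x : config) (z i : int) (p H : nat) :
    z <= i -> i + p%:Z <= z + H%:Z ->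
  (\sum_(r < p) x (i + r%:Z)%R =
   \sum_(h < H) if (i <= z + h%:Z < i + p%:Z)%R then x (z + h%:Z)%R else 0)%N.
Proof.
move=> zi ipH; have [d di] : exists d : nat, i = z + d%:Z.
  by exists (absz (i - z)); lia.
have [e eH] : exists e : nat, H = (d + p + e)%N by exists (H - (d + p))%N; lia.
rewrite {}eH {H ipH zi}; subst i.
rewrite -(big_mkord xpredT (fun h => if (z + d%:Z <= z + h%:Z < _)%R then x (z + h%:Z)%R else 0%N)).
rewrite (@big_cat_nat _ _ _ (d + p)%N) ?leq_addr //=.
rewrite (@big_cat_nat _ _ _ d) ?leq_addr //=.
rewrite [X in (X + _ + _)%N]big_nat [X in (X + _ + _)%N]big1; last first.
  by move=> h hd; case: ifP => //; lia.
rewrite [X in (_ + _ + X)%N]big_nat [X in (_ + _ + X)%N]big1; last first.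
  by move=> h hd; case: ifP => //; lia.
rewrite add0n addn0 -[X in index_iota X _](add0n d) big_addn addKn big_mkord.
apply: eq_bigr => r _; have rp := ltn_ord r.
rewrite (_ : (z + d%:Z <= z + (r + d)%N%:Z < z + d%:Z + p%:Z) = true); last by lia.
by congr x; lia.
Qed.

(** In a window that contains the stretch of length [q] from [b], erasing this
stretch of [x] pays for adding [W] on the stretch of length [k] from [c], wherever
the latter lies with respect to the window. *)
Lemma window_sum_exchange (x y W : config) (i b c : int) (p q k : nat) :
    i <= b -> b + q%:Z <= i + p%:Z ->
    (forall j, (y j <= (if (b <= j < b + q%:Z)%R then 0 else x j)
                     + (if (c <= j < c + k%:Z)%R then W j else 0))%N) ->
    (\sum_(r < k) W (c + r%:Z)%R <= \sum_(r < q) x (b + r%:Z)%R)%N ->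
  (\sum_(r < p) y (i + r%:Z)%R <= \sum_(r < p) x (i + r%:Z)%R)%N.
Proof.
move=> ib bi yxW Wx.
rewrite -(leq_add2r (\sum_(r < q) x (b + r%:Z)%R)).
apply: leq_trans (leq_add (leqnn _) Wx).
pose z := - (absz i + absz c)%N%:Z.
pose H := (2 * (absz i + absz c) + p + k + q)%N.
rewrite !(@window_sum_enlarge _ z _ _ H); try by rewrite /z /H; lia.
rewrite -!big_split /=; apply: leq_sum => h _.
have := yxW (z + h%:Z); set j := z + _.
case: (boolP (b <= j < b + q%:Z)) => jb; case: (boolP (i <= j < i + p%:Z)) => ji;
  case: (boolP (c <= j < c + k%:Z)) => jc; lia.
Qed.

(** In terms of planting: [A] starts at [a], and the lengths of [A], [W], [C] are [p], [k], [q]. *)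
Definition overwrite (x : config) (a : int) (p k q : nat) (w : nat -> nat) : config :=
  fun i => if a + p%:Z <= i < a + (p + k)%N%:Z then w (absz (i - (a + p%:Z))%R)
           else if a <= i < a + (p + k + q)%N%:Z then 0%N else x i.

Definition padded_word (k : nat) (w : nat -> nat) : config :=
  fun i => if 0 <= i < k%:Z then w (absz i) else 0%N.

Section BoundedDensity.
Variables (R : realType) (f : nat -> R).
Local Notation X := (bounded_density_shift f).

Lemma bounded_density_hereditary (x y : config) :
  X x -> (forall i, (y i <= x i)%N) -> X y.
Proof.
move=> Xx yx p p0 i; apply: le_trans (Xx p p0 i).
by rewrite ler_nat; apply: leq_sum.
Qed.

(** The two erased stretches act as barriers.  A window inside the overwritten
part sees only a part of [w]; one that leaves this part and meets the copy of [w]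
contains a whole barrier, whose former sum dominates that of [w]; one that misses
the copy of [w] only loses mass. *)
Lemma bounded_density_overwrite (x : config) (a : int) (p k q : nat) (w : nat -> nat) :
    X x -> X (padded_word k w) ->
    (\sum_(r < k) w r <= \sum_(r < p) x (a + r%:Z)%R)%N ->
    (\sum_(r < k) w r <= \sum_(r < q) x (a + (p + k)%N%:Z + r%:Z)%R)%N ->
  X (overwrite x a p k q w).
Proof.
move=> Xx Xw left right n n0 i.
pose W : config := fun j => w (absz (j - (a + p%:Z))%R).
have WE : (\sum_(r < k) W (a + p%:Z + r%:Z)%R = \sum_(r < k) w r)%N.
  by apply: eq_bigr => r _; congr w; lia.
have [inside|] := boolP ((a <= i) && (i + n%:Z <= a + (p + k + q)%N%:Z)).
  apply: le_trans (Xw n n0 (i - (a + p%:Z))).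
  rewrite ler_nat; apply: leq_sum => r _; rewrite /overwrite /padded_word.
  have rn := ltn_ord r.
  rewrite (_ : (0 <= _ < _) = (a + p%:Z <= i + r%:Z < a + (p + k)%N%:Z)); last by lia.
  case: ifP => _; first by apply: eq_leq; congr w; lia.
  by rewrite (_ : _ && _ = true) //; lia.
rewrite negb_and -!ltNge => outside.
apply: le_trans (Xx n n0 i); rewrite ler_nat.
have [disj|] := boolP ((i + n%:Z <= a + p%:Z) || (a + (p + k)%N%:Z <= i)).
  apply: leq_sum => r _; rewrite /overwrite; have rn := ltn_ord r.
  by rewrite (_ : (a + p%:Z <= _ < _) = false) ?if_same; [case: ifP|lia].
rewrite negb_or -!ltNge => meets.
have [ia|ai] := ltP i a.
  apply: (@window_sum_exchange x _ W i a (a + p%:Z) n p k); try lia.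
  move=> j; rewrite /overwrite -addrA -PoszD /W.
  by case: ifP => ?; case: ifP => ?; try lia; case: ifP => ?; lia.
apply: (@window_sum_exchange x _ W i (a + (p + k)%N%:Z) (a + p%:Z) n q k); try lia.
move=> j; rewrite /overwrite -!addrA -!PoszD /W.
by case: ifP => ?; case: ifP => ?; try lia; case: ifP => ?; lia.
Qed.

End BoundedDensity.

(** * Fekete's lemma *)

(** The limit is the infimum: if [u p / p] is close to it, then dividing [n] by
[p] with remainder bounds [u n / n] by [u p / p] plus a term of order [1 / n]. *)
Lemma subadditive_mean_cvg (R : realType) (u : nat -> R) :
    (forall n, 0 <= u n) -> (forall m n, u (m + n)%N <= u m + u n) ->
  cvgn (fun n => u n / n%:R).
Proof.
move=> u_ge0 uD.
pose E : set R := [set u n / n%:R | n in [set n | (0 < n)%N]].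
have E_inf : has_inf E.
  split; first by exists (u 1%N / 1%:R); exists 1%N.
  by exists 0 => _ [n _ <-]; apply: divr_ge0.
apply/cvg_ex; exists (inf E); apply/cvgrPdist_le => /= e e0.
have [_ [p p0 <-] pE] := inf_adherent (divr_gt0 e0 (ltr0Sn R 1)) E_inf.
pose C := \sum_(r < p) u r.
have uC n : u n <= (n %/ p)%:R * u p + C.
  have uq q : u (q * p + n %% p)%N <= q%:R * u p + u (n %% p)%N.
    elim: q => [|q IH]; first by rewrite mul0n mul0r add0n add0r.
    rewrite mulSn -addnA; apply: le_trans (uD _ _) _.
    by rewrite -natr1 mulrDl mul1r (addrC (_ * _)) -addrA lerD2l.
  have np : (n %% p < p)%N by rewrite ltn_mod.
  rewrite {1}(divn_eq n p); apply: le_trans (uq _) _; rewrite lerD2l.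
  by rewrite /C (bigD1 (Ordinal np)) //= lerDl sumr_ge0.
near=> n.
have n0 : 0 < n%:R :> R by rewrite ltr0n; near: n; exists 1%N.
have infn : inf E <= u n / n%:R.
  by apply: ge_inf; [have [] := E_inf|exists n => //; rewrite /= -(ltr0n R)].
rewrite distrC ger0_norm ?subr_ge0 //.
have Cn : C / n%:R <= e / 2.
  rewrite ler_pdivrMr // -ler_pdivrMl ?divr_gt0 //.
  near: n; exact: nbhs_infty_ger.
have : u n / n%:R <= u p / p%:R + C / n%:R.
  rewrite ler_pdivrMr // mulrDl divfK ?gt_eqF //.
  apply: le_trans (uC n) _; rewrite lerD2r mulrC -mulrA ler_wpM2l //.
  by rewrite ler_pdivlMl ?ltr0n // -natrM ler_nat mulnC leq_trunc_div.
move: pE; lra.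
Unshelve. all: by end_near.
Qed.

(** * Bounded density shifts with positive limiting gradient *)

Section BoundedDensityShift.
Variables (R : realType) (f : nat -> R).
Local Notation X := (bounded_density_shift f).

Lemma bounded_density_translate (x : config) (c : int) :
  X x -> X (fun i => x (i + c)).
Proof.
move=> Xx p p0 i; have := Xx p p0 (i + c).
by under eq_bigr do rewrite addrAC.
Qed.

Lemma bounded_density_subshift : canonical_fun f -> subshift X.
Proof.
move=> [f_ge0 _ _ _]; split.
- move=> x clx p p0 i.
  have [y [Xy yx]] : X `&` [set y : config | forall r : 'I_p, y (i + r%:Z) = x (i + r%:Z)] !=set0.
    apply: clx; apply: (filter_forall (F := nbhs x)
      (f := fun (r : 'I_p) (y : config) => y (i + r%:Z) = x (i + r%:Z))) => r.
    exact: nbhs_coordinate.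
  by under eq_bigr do rewrite -yx; exact: Xy.
- apply/seteqP; split=> [_ [x Xx <-]|x Xx]; first exact: (bounded_density_translate _ Xx).
  exists (fun i => x (i - 1)); first exact: (bounded_density_translate _ Xx).
  by apply/funext => i; rewrite /shift /=; congr x; lia.
- exists (Num.truncn (f 1%N)) => x Xx i.
  have := Xx 1%N isT i; rewrite big_ord1 addr0.
  by rewrite truncn_ge_nat.
Qed.

Definition comb (N : nat) : config := fun i => (N%:Z %| i)%Z.

Lemma comb_window_sum (N p : nat) (i : int) : (0 < N)%N ->
  (\sum_(r < p) comb N (i + r%:Z)%R <= p %/ N + 1)%N.
Proof.
move=> N0; have short (q : nat) (j : int) : (q <= N)%N -> (\sum_(r < q) comb N (j + r%:Z)%R <= 1)%N.
  move=> qN.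
  rewrite (eq_bigr (fun r : 'I_q => if (N%:Z %| (j + r%:Z)%R)%Z then 1 else 0)%N);
    last first.
    by move=> r _; rewrite /comb; case: (_ %| _)%Z.
  rewrite -big_mkcond /= sum1_card; apply/card_le1_eqP => r s.
  move=> Nr Ns; apply/esym/val_inj => /=.
  have : (N%:Z %| (j + r%:Z - (j + s%:Z))%R)%Z by apply: rpredB; [exact: Nr | exact: Ns].
  rewrite (_ : _ - _ = r%:Z - s%:Z); last by lia.
  case/dvdzP => t rst.
  have rq := ltn_ord r; have sq := ltn_ord s.
  have t0 : t = 0 by nia.
  by move: rst; rewrite t0; lia.
have [m] := ubnP p; elim: m p i => // m IH p i pm.
have [pN|Np] := ltnP p N; first by rewrite divn_small // short // ltnW.
have [q pq] : exists q, p = (N + q)%N by exists (p - N)%N; lia.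
rewrite pq big_split_ord /= divnDl ?dvdnn // divnn N0 -addnA leq_add //; first exact: short.
rewrite (eq_bigr (fun r : 'I_q => comb N (i + N%:Z + r%:Z)%R)); last first.
  by move=> r _; rewrite PoszD addrA.
by apply: IH; lia.
Qed.

(** With [a] the limiting gradient, [f p >= a / 2 * p] for large [p].  A window of
length [p] contains at most [p / N + 1] multiples of [N]; for [p >= N] this is at
most [2 p / N], and [N >= 4 / a] suffices; for [p < N] it is at most [1 <= f 1]. *)
Lemma comb_mem : canonical_fun f -> 1 <= f 1%N -> 0 < limiting_gradient f ->
  exists N, (0 < N)%N /\ X (comb N).
Proof.
move=> [f_ge0 f0 fS fD] f1 al.
have f_mono : {homo f : m n / (m <= n)%N >-> m <= n} by apply: homo_leq => //; exact: le_trans.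
have f_sub m n : f (m + n)%N <= f m + f n.
  case: m => [|m]; first by rewrite add0n f0 add0r.
  by case: n => [|n]; [rewrite addn0 f0 addr0|exact: fD].
have := subadditive_mean_cvg f_ge0 f_sub.
set a := limiting_gradient f in al *.
move=> /cvgr_gt /(_ (a / 2)) /(_ _)[]; first by rewrite ltr_pdivrMr // ltr_pMr // ltr1n.
move=> n0 _ fa; exists (maxn n0.+1 (Num.truncn (4 / a)).+1); split=> [|p p0 i].
  by rewrite leq_max.
set N := maxn _ _; have N0 : (0 < N)%N by rewrite leq_max.
apply: (@le_trans _ _ (p %/ N + 1)%N%:R); first by rewrite ler_nat comb_window_sum.
have [pN|Np] := ltnP p N; first by rewrite divn_small // (le_trans f1) // f_mono.
have pgt0 : 0 < p%:R :> R by rewrite ltr0n.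
have /ltW : a / 2 < f p / p%:R.
  by apply: fa; apply: leq_trans Np; rewrite leq_max leqnSn.
rewrite ler_pdivlMr // => fap; apply: le_trans fap.
have Na : 4 / a <= N%:R.
  apply/ltW/(lt_le_trans (truncnS_gt _)); rewrite ler_nat leq_max orbC leqnn //.
have pN1 : (1 <= p %/ N)%N by rewrite divn_gt0.
apply: (@le_trans _ _ (2 * (p %/ N)%N%:R)); first by rewrite -natrM ler_nat; lia.
have : (p %/ N)%N%:R * N%:R <= p%:R :> R by rewrite -natrM ler_nat leq_trunc_div.
move: Na; rewrite ler_pdivrMr // => Na.
have : 0 <= (p %/ N)%N%:R :> R by [].
by nra.
Qed.

End BoundedDensityShift.

(** * Words of a subshift, read block by block *)

Section BlockWords.
Variables (m N L : nat).
Local Notation word := {ffun 'I_N -> {ffun 'I_L -> 'I_m.+1}}.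

Definition block_word (x : config) : word :=
  [ffun j : 'I_N => [ffun i : 'I_L => inord (x (j * L + i)%N%:Z)]].

Definition block_words (X : set config) : {set word} :=
  [set u | `[< exists2 x, X x & block_word x = u >]]%SET.

Lemma block_wordsP (X : set config) (u : word) :
  reflect (exists2 x, X x & block_word x = u) (u \in block_words X).
Proof. by rewrite inE; exact: asboolP. Qed.

Lemma block_wordE (x : config) (j : 'I_N) (i : 'I_L) :
  (forall a, (x a <= m)%N) -> block_word x j i = x (j * L + i)%N%:Z :> nat.
Proof. by move=> xm; rewrite !ffunE inordK // ltnS. Qed.

Lemma block_word_inj (x x' : config) (n : nat) :
    (forall a, (x a <= m)%N) -> (forall a, (x' a <= m)%N) ->
    block_word x = block_word x' -> (n < N * L)%N -> x n = x' n.
Proof.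
move=> xm xm' xx' nNL.
have L0 : (0 < L)%N by case: L nNL => //; rewrite muln0.
have jN : (n %/ L < N)%N by rewrite ltn_divLR.
have iL : (n %% L < L)%N by rewrite ltn_mod.
have := block_wordE (Ordinal jN) (Ordinal iL) xm.
by rewrite xx' block_wordE //= -divn_eq.
Qed.

End BlockWords.

Lemma language_finite (X : set config) (m n : nat) :
  (forall x, X x -> forall i, (x i <= m)%N) -> finite_set (language X n).
Proof.
move=> Xm; pose F (u : {ffun 'I_n -> 'I_m.+1}) := [tuple (u i : nat) | i < n].
apply: (@sub_finite_set _ _ (range F)); last exact/finite_image/finite_finset.
move=> w [x [Xx [i wx]]]; exists [ffun k => inord (tnth w k)] => //.
apply: eq_from_tnth => k; rewrite tnth_mktuple ffunE inordK // ltnS wx.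
exact: Xm.
Qed.

(** By shift invariance only the words read from the origin matter. *)
Lemma card_language_blocks (X : set config) (m N L : nat) :
    subshift X -> (forall x, X x -> forall i, (x i <= m)%N) ->
  #|` fset_set (language X (N * L))|%fset = #|block_words m N L X|.
Proof.
move=> sX Xm.
have fin := @language_finite X m (N * L)%N Xm.
pose c (w : (N * L).-tuple nat) : config := fun i => nth 0%N w (absz i).
have lang_bounded w : w \in fset_set (language X (N * L)) -> forall i, (c w i <= m)%N.
  rewrite in_fset_set // inE => -[x [Xx [a wx]]] i.
  have [iw|wi] := ltnP (absz i) (N * L); last by rewrite /c nth_default ?size_tuple.
  have := wx (Ordinal iw); rewrite (tnth_nth 0%N) /= /c => ->.
  exact: Xm.
pose s := enum_fset (fset_set (language X (N * L))).
have inj : {in s &, injective (fun w => block_word m N L (c w))}.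
  move=> w w' ws ws' ww'; apply: eq_from_tnth => k; rewrite !(tnth_nth 0%N).
  have := block_word_inj (lang_bounded _ ws) (lang_bounded _ ws') ww' (ltn_ord k).
  by [].
have us : uniq [seq block_word m N L (c w) | w <- s] by rewrite map_inj_in_uniq // fset_uniq.
rewrite -[LHS](size_map (fun w => block_word m N L (c w))) -(card_uniqP us).
apply: eq_card => u; apply/mapP/block_wordsP.
  move=> [w]; rewrite in_fset_set // inE => -[x [Xx [a wx]]] ->.
  exists (fun i => x (i + a)); first exact: (subshift_translate _ sX Xx).
  apply/ffunP => j; apply/ffunP => i; rewrite !ffunE; congr inord.
  have kNL : (j * L + i < N * L)%N.
    have := ltn_ord j; have := ltn_ord i; nia.
  by have := wx (Ordinal kNL); rewrite (tnth_nth 0%N) /= /c /= => ->; rewrite addrC.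
move=> [x Xx <-]; pose w := [tuple x (i : nat)%:Z | i < N * L].
exists w.
  rewrite in_fset_set // inE; exists x; split=> //; exists 0 => k.
  by rewrite tnth_mktuple add0r.
apply/ffunP => j; apply/ffunP => i; rewrite !ffunE; congr inord.
have kNL : (j * L + i < N * L)%N.
  have := ltn_ord j; have := ltn_ord i; nia.
have := tnth_mktuple (fun i : 'I_(N * L) => x (i : nat)%:Z) (Ordinal kNL).
by rewrite (tnth_nth 0%N) /= /c => ->.
Qed.

Lemma card_language_submul (X : set config) (m p q : nat) :
    (forall x, X x -> forall i, (x i <= m)%N) ->
  (#|` fset_set (language X (p + q))|%fset <=
   #|` fset_set (language X p)|%fset * #|` fset_set (language X q)|%fset)%N.
Proof.
move=> Xm; have fin n := @language_finite X m n Xm.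
rewrite -(size_allpairs (fun (a : p.-tuple nat) (b : q.-tuple nat) => [tuple of a ++ b])).
apply: uniq_leq_size; first exact: fset_uniq.
move=> w; rewrite (in_fset_set (fin _)) => /set_mem[x [Xx [i wx]]].
apply/allpairsP.
exists ([tuple x (i + (r : nat)%:Z) | r < p], [tuple x (i + (p + r)%N%:Z) | r < q]).
rewrite /= !(in_fset_set (fin _)); split; try apply/mem_set.
- by exists x; split=> //; exists i => r; rewrite tnth_mktuple.
- by exists x; split=> //; exists (i + p%:Z) => r; rewrite tnth_mktuple PoszD addrA.
apply: eq_from_tnth => k; rewrite wx.
by case: (split_ordP k) => r ->; rewrite ?tnth_lshift ?tnth_rshift tnth_mktuple.
Qed.

Lemma card_language_gt0 (X : set config) (m n : nat) :
    X !=set0 -> (forall x, X x -> forall i, (x i <= m)%N) ->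
  (0 < #|` fset_set (language X n)|%fset)%N.
Proof.
move=> [x Xx] Xm; rewrite cardfs_gt0; apply/fset0Pn.
exists [tuple x (r : nat)%:Z | r < n].
rewrite in_fset_set ?inE; last exact: language_finite Xm.
by exists x; split=> //; exists 0 => r; rewrite tnth_mktuple add0r.
Qed.

(** * Good blocks and planting *)

Section Marking.
Variables (m L k : nat) (w : nat -> nat).
Local Notation block := {ffun 'I_L -> 'I_m.+1}.
Local Notation s := (\sum_(r < k) w r)%N.

Definition bval (b : block) (i : nat) : nat :=
  if insub i is Some j then b j else 0%N.

Lemma bvalE (b : block) (i : 'I_L) : bval b i = b i.
Proof. by rewrite /bval valK. Qed.

Lemma bval_le (b : block) i : (bval b i <= m)%N.
Proof. by rewrite /bval; case: insubP => // j _ _; rewrite -ltnS. Qed.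

(** The offsets at which [w] may be planted: what is erased on either side then
pays for the copy of [w]. *)
Definition cut (b : block) (t : nat) : bool :=
  [&& (t + k <= L)%N, (s <= \sum_(i < t) bval b i)%N
    & (s <= \sum_(i < L - (t + k)) bval b (t + k + i))%N].

Definition good_block (b : block) : bool := [exists t : 'I_L.+1, cut b t].

Definition cut_point (b : block) : nat :=
  if [pick t : 'I_L.+1 | cut b t] is Some t then t : nat else 0%N.

Lemma cut_pointP (b : block) : good_block b -> cut b (cut_point b).
Proof. by rewrite /cut_point => /existsP[t bt]; case: pickP => // /(_ t); rewrite bt. Qed.

Definition plant (b : block) : block :=
  [ffun i : 'I_L => if (cut_point b <= i < cut_point b + k)%N
                    then inord (w (i - cut_point b)) else ord0].

Definition marked (b : block) : bool :=
  [exists t : 'I_L.+1, (t + k <= L)%N && [forall r : 'I_k, bval b (t + r) == w r]].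

Lemma plant_marked (b : block) : (forall r, (w r <= m)%N) -> good_block b -> marked (plant b).
Proof.
move=> wm /cut_pointP; set t := cut_point b => /and3P[tL _ _].
have tL1 : (t < L.+1)%N by lia.
apply/existsP; exists (Ordinal tL1); rewrite /= tL; apply/forallP => r; apply/eqP.
have rk := ltn_ord r; have trL : (t + r < L)%N by lia.
rewrite (bvalE _ (Ordinal trL)) ffunE /= -/t leq_addr ltn_add2l rk addKn.
by rewrite inordK // ltnS.
Qed.

(** Let [t] be the least offset before which the sum reaches that of [w].  It
exceeds this value by less than one letter, so up to the end of the copy of [w]
the sum is at most [s + m + k * m], and what remains is at least [s]. *)
Lemma bad_block_sum (b : block) :
  ~~ good_block b -> (\sum_i b i <= s + m + k * m + s)%N.
Proof.
apply: contraNT; rewrite -ltnNge => big.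
pose P t := (\sum_(i < t) bval b i)%N.
have PL : (\sum_i b i)%N = P L by apply: eq_bigr => i _; rewrite bvalE.
rewrite {}PL in big.
have PD t e : P (t + e)%N = (P t + \sum_(i < e) bval b (t + i))%N.
  by rewrite /P big_split_ord.
have ex : exists t, (s <= P t)%N.
  by exists L; lia.
pose t := ex_minn ex; have [st tmin] : (s <= P t)%N /\ forall n, (s <= P n)%N -> (t <= n)%N.
  by rewrite /t; case: ex_minnP.
clearbody t.
have Pt : (P t <= s + m)%N.
  case: t st tmin => [|t] st tmin; first by rewrite /P big_ord0.
  have ts : (P t < s)%N by rewrite ltnNge; apply/negP => /tmin; rewrite ltnn.
  have -> : P t.+1 = (P t + bval b t)%N by rewrite /P big_ord_recr.
  by have := bval_le b t; lia.
have Ptk : (P (t + k) <= s + m + k * m)%N.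
  rewrite PD leq_add // -[k in leqRHS]card_ord -sum_nat_const.
  by apply: leq_sum => i _; exact: bval_le.
have tkL : (t + k <= L)%N.
  rewrite leqNgt; apply/negP => Ltk.
  have : (P L <= P (t + k))%N by rewrite -(subnKC (ltnW Ltk)) PD leq_addr.
  by lia.
have tL1 : (t < L.+1)%N by lia.
apply/existsP; exists (Ordinal tL1); apply/and3P; split => //=.
rewrite -(leq_add2l (P (t + k)%N)) -PD subnKC //.
by apply: leq_trans (ltnW big); rewrite leq_add2r.
Qed.

Lemma card_bad_blocks :
  (#|[pred b | ~~ good_block b]| <= L.+1 ^ (s + m + k * m + s))%N.
Proof.
apply: leq_trans (card_small_sum L m _); apply: subset_leq_card.
by apply/fintype.subsetP => b; rewrite !inE => /bad_block_sum.
Qed.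

End Marking.

Section Planting.
Variables (R : realType) (f : nat -> R) (m N L k : nat) (w : nat -> nat).
Local Notation X := (bounded_density_shift f).
Hypothesis Xm : forall x, X x -> forall i, (x i <= m)%N.

Lemma bval_block_word (x : config) (j : 'I_N) (i : nat) :
  (forall a, (x a <= m)%N) -> (i < L)%N ->
  bval (block_word m N L x j) i = x (j * L + i)%N%:Z.
Proof. by move=> xm iL; rewrite (bvalE _ (Ordinal iL)) block_wordE. Qed.

(** The blocks are treated from left to right.  Planting changes the point only
inside the current block, so the blocks still to be treated keep their contents,
and with them their cuts. *)
Lemma plant_block_words (Y : set config) (u : {ffun 'I_N -> {ffun 'I_L -> 'I_m.+1}})
    (S : {set 'I_N}) :
    Y `<=` X -> X (padded_word k w) -> u \in block_words m N L Y ->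
    (forall j, j \in S -> good_block k w (u j)) ->
  rewrite_blocks (plant k w) S u \in block_words m N L X.
Proof.
move=> YX Xw /block_wordsP[y Yy <-{u}]; set u := block_word _ _ _ y => goodS.
suff H n : (n <= N)%N -> exists2 x, X x &
    forall j, block_word m N L x j = if (j < n)%N && (j \in S) then plant k w (u j) else u j.
  have [x Xx xu] := H N (leqnn N); apply/block_wordsP; exists x => //.
  by apply/ffunP => j; rewrite xu ltn_ord /= [RHS]ffunE.
elim: n => [_|n IH nN]; first by exists y => //; exact: YX.
have [x Xx xu] := IH (ltnW nN).
clearbody u.
pose jn := Ordinal nN.
have [nS|nS] := boolP (jn \in S); last first.
  exists x => // j; rewrite xu ltnS (leq_eqVlt j).
  have [jnE|//] := eqVneq (j : nat) n.
  by have -> : j = jn by [exact: val_inj]; rewrite (negbTE nS) !andbF.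
have un : block_word m N L x jn = u jn by rewrite xu /= ltnn.
have /cut_pointP := goodS _ nS; set t := cut_point _ _ _ => /and3P[tL left right].
have xm := Xm Xx.
have bx i : (i < L)%N -> bval (u jn) i = x ((n * L)%N%:Z + i%:Z).
  by move=> iL; rewrite -un bval_block_word.
exists (overwrite x (n * L)%N%:Z t k (L - (t + k))%N w).
  apply: bounded_density_overwrite => //.
    apply: leq_trans left _; apply: eq_leq; apply: eq_bigr => i _; apply: bx.
    by have := ltn_ord i; lia.
  apply: leq_trans right _; apply: eq_leq; apply: eq_bigr => i _; rewrite bx; last first.
    by have := ltn_ord i; lia.
  by congr x; lia.
move=> j; have [jnE|jn'] := eqVneq (j : nat) n.
  have -> : j = jn by exact: val_inj.
  rewrite leqnn nS /=; apply/ffunP => i; rewrite !ffunE /= -/t.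
  have iL := ltn_ord i.
  rewrite /overwrite.
  rewrite (_ : (_ <= _ < (n * L)%N%:Z + (t + k)%N%:Z) = (t <= i < t + k)%N); last by lia.
  case: ifP => ti; first by congr (inord (w _)); lia.
  rewrite (_ : _ && _ = true); last by lia.
  by apply/val_inj; rewrite /= inordK.
rewrite ltnS (leq_eqVlt j) (negbTE jn') /= -xu.
apply/ffunP => i; rewrite !ffunE /overwrite; have iL := ltn_ord i.
have far : ((j.+1 * L <= n * L) || (n.+1 * L <= j * L))%N.
  by apply/orP; case: (ltngtP j n) jn' => // lt_jn _; [left|right]; rewrite leq_mul2r lt_jn orbT.
rewrite (_ : (_ <= _ < (n * L)%N%:Z + (t + k)%N%:Z) = false); last by lia.
by rewrite (_ : (_ <= _ < _) = false) //; lia.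
Qed.

Lemma block_words_unmarked (Y : set config) (u : {ffun 'I_N -> {ffun 'I_L -> 'I_m.+1}}) (j : 'I_N) :
    Y `<=` X ->
    (forall y (c : int), Y y -> ~ (forall r, (r < k)%N -> y (c + r%:Z) = w r)) ->
    u \in block_words m N L Y ->
  ~~ marked k w (u j).
Proof.
move=> YX Yw /block_wordsP[y Yy <-]; apply/negP => /existsP[t /andP[tL /forallP h]].
apply: (Yw y (j * L + t)%N Yy) => r rk.
rewrite -(eqP (h (Ordinal rk))) bval_block_word //=; first by congr y; lia.
  exact/Xm/YX.
by lia.
Qed.

(** Every set of teeth of the comb gives a point of the hereditary set [X], and
a block of length [L = N0 * l] contains [l] teeth. *)
Lemma card_comb_words (N0 l : nat) :
    (0 < N0)%N -> L = (N0 * l)%N -> X (comb N0) ->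
  (2 ^ (N * l) <= #|block_words m N L X|)%N.
Proof.
move=> N0p Ll Xc.
have m1 : (1 <= m)%N by have := Xm Xc 0; rewrite /comb dvdz0.
pose z (A : {set 'I_(N * l)}) : config :=
  fun i => if [exists t in A, i == (t * N0)%N%:Z] then 1%N else 0%N.
have Xz A : X (z A).
  apply: bounded_density_hereditary Xc _ => i; rewrite /z /comb.
  case: ifP => // /exists_inP[t _ /eqP->].
  by rewrite PoszM dvdz_mull.
have -> : (2 ^ (N * l) = #|{set 'I_(N * l)}|)%N.
  by rewrite -cardsT -powersetT card_powerset cardsT card_ord.
rewrite -(card_imset (f := fun A => block_word m N L (z A))).
  apply: subset_leq_card; apply/fintype.subsetP => _ /imsetP[A _ ->].
  by apply/block_wordsP; exists (z A).
move=> A A' AA'; apply/setP => t.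
have zE (C : {set 'I_(N * l)}) : (t \in C) = (z C (t * N0)%N%:Z == 1%N).
  rewrite /z; case: exists_inP => [[t' Ct' /eqP[tt']]|nC].
    suff -> : t = t' by [].
    by apply/val_inj; apply/eqP; rewrite -(eqn_pmul2r N0p); apply/eqP.
  by apply/negP => Ct; apply: nC; exists t.
rewrite !zE; congr (_ == _).
apply: (block_word_inj _ _ AA'); try exact: Xm.
by rewrite Ll mulnCA (mulnC N0) ltn_pmul2r.
Qed.

End Planting.

(** * Comparison of the entropies *)

(** Choice of the parameters.  With [L = 4 N0 l], each block contains [4 l] teeth
of the comb.  The bad blocks are so few that [b + 1 <= 2 ^ l] for large [l], and
[D <= 2 ^ (q * l)] for [q = 4 (m + 1) N0].  Hence [D * (b + 1) ^ q <= F] with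
[F = 2 ^ (2 q l)], while words of [j * q] blocks contain [4 q l j] teeth, so that
there are at least [F ^ (2 j)] of them in [X]. *)
Lemma word_count_gap (R : realType) (f : nat -> R) (Y : set config) (m N0 k : nat)
    (w : nat -> nat) :
    let X := bounded_density_shift f in
    subshift X -> (forall x, X x -> forall i, (x i <= m)%N) ->
    (0 < N0)%N -> X (comb N0) -> X (padded_word k w) -> (forall r, (w r <= m)%N) ->
    subshift Y -> Y `<=` X ->
    (forall y (c : int), Y y -> ~ (forall r, (r < k)%N -> y (c + r%:Z) = w r)) ->
  exists c D : nat, [/\ (0 < c)%N, (0 < D)%N & forall j : nat,
    (#|` fset_set (language Y (j * c))|%fset * D.+1 ^ j <=
     2 * #|` fset_set (language X (j * c))|%fset * D ^ j)%N].
Proof.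
move=> X sX Xm N0p Xc Xw wm sY YX Yw.
pose s := (\sum_(r < k) w r)%N; pose s' := (s + m + k * m + s)%N.
have [l l0 ls] := exists_exp_dominates (4 * N0) s'.
pose L := (N0 * (4 * l))%N; pose q := (4 * m.+1 * N0)%N.
have q0 : (0 < q)%N by rewrite !muln_gt0.
have L0 : (0 < L)%N by rewrite !muln_gt0 N0p l0.
exists (q * L)%N, #|{ffun 'I_L -> 'I_m.+1}|.
have D0 : (0 < #|{ffun 'I_L -> 'I_m.+1}|)%N by rewrite card_ffun !card_ord expn_gt0.
split=> [||j]; [by rewrite muln_gt0 q0 | exact: D0 |].
rewrite mulnA.
rewrite (card_language_blocks (j * q) L sX Xm).
rewrite (card_language_blocks (j * q) L sY (fun y Yy => Xm y (YX y Yy))).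
apply: (@rewriting_gain _ _ (@good_block m L k w) (@marked m L k w) (plant k w)
          _ _ j q (2 ^ (2 * q * l))%N) => //.
- by rewrite -{1}(expn1 2) leq_exp2l // !muln_gt0 N0p l0.
- by move=> u S uY goodS; exact: (plant_block_words Xm YX Xw uY goodS).
- by move=> u i uY; exact: (block_words_unmarked Xm i YX Yw uY).
- by move=> b; apply: plant_marked.
- have bad : (#|[pred b | ~~ @good_block m L k w b]|.+1 <= 2 ^ l)%N.
    apply: leq_ltn_trans (card_bad_blocks m L k w) _.
    by have -> : L = (4 * N0 * l)%N by rewrite /L; lia.
  have Dle : (#|{ffun 'I_L -> 'I_m.+1}| <= 2 ^ (q * l))%N.
    rewrite card_ffun !card_ord.
    apply: (@leq_trans ((2 ^ m.+1) ^ L)%N).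
      by rewrite leq_exp2r // ltnW // ltn_expl.
    by rewrite -expnM leq_exp2l // /L /q; nia.
  apply: leq_trans (_ : 2 ^ (q * l) * (2 ^ l) ^ q <= _)%N.
    by rewrite leq_mul // leq_exp2r.
  by rewrite -expnM -expnD leq_exp2l //; nia.
- rewrite -expnM.
  apply: leq_trans (card_comb_words (j * q) Xm N0p (erefl L) Xc).
  by rewrite leq_exp2l //; nia.
Qed.

Lemma htop_cvg (R : realType) (X : set config) : subshift X -> X !=set0 ->
  (fun n => ln (#|` fset_set (language X n)|%fset%:R : R) / n%:R) @ \oo --> htop R X.
Proof.
move=> [_ _ [m Xm]] X0.
apply: (@subadditive_mean_cvg R (fun n => ln #|` fset_set (language X n)|%fset%:R)).
  move=> n; apply: ln_ge0; rewrite ler1n; exact: card_language_gt0 Xm.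
move=> p q; rewrite -lnM ?posrE ?ltr0n ?(card_language_gt0 _ X0 Xm) //.
rewrite -natrM ler_ln ?posrE ?ltr0n ?muln_gt0 ?(card_language_gt0 _ X0 Xm) //.
by rewrite ler_nat; exact: card_language_submul Xm.
Qed.

(** Taking logarithms, the mean exponents at length [j * c] differ by at least
[g - ln 2 / (j * c)], where [g] is [ln (D.+1 / D) / c]; half of [g] survives in
the limit. *)
Lemma htop_lt (R : realType) (X Y : set config) (c D : nat) :
    subshift X -> X !=set0 -> subshift Y -> Y !=set0 -> (0 < c)%N -> (0 < D)%N ->
    (forall j : nat,
      (#|` fset_set (language Y (j * c))|%fset * D.+1 ^ j <=
       2 * #|` fset_set (language X (j * c))|%fset * D ^ j)%N) ->
  htop R Y < htop R X.
Proof.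
move=> sX X0 sY Y0 c0 D0 YX.
have cR : 0 < c%:R :> R by rewrite ltr0n.
pose g : R := (ln D.+1%:R - ln D%:R) / c%:R.
have g0 : 0 < g by rewrite divr_gt0 // subr_gt0 ltr_ln ?posrE ?ltr0n // ltr_nat.
suff : htop R Y <= htop R X - g / 2.
  by move=> /le_lt_trans; apply; rewrite gtrBl divr_gt0.
have sub (Z : set config) : subshift Z -> Z !=set0 ->
    (fun j => ln (#|` fset_set (language Z (j * c))|%fset%:R : R) / (j * c)%N%:R) @ \oo
      --> htop R Z.
  move=> sZ Z0; exact: (cvg_comp _ _ (cvg_mulnr c c0) (@htop_cvg R Z sZ Z0)).
apply: (ler_cvg_to (sub Y sY Y0) (cvgB (sub X sX X0) (cvg_cst (g / 2)))).
near=> j.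
have j0 : (0 < j)%N by near: j; exists 1%N.
have jcR : 0 < (j * c)%N%:R :> R by rewrite ltr0n muln_gt0 j0.
have gc0 : 0 < g / 2 * c%:R by apply: mulr_gt0 => //; apply: divr_gt0.
have jg : ln 2 / (g / 2 * c%:R) <= j%:R by near: j; exact: nbhs_infty_ger.
have [_ _ [mX Xm]] := sX; have [_ _ [mY Ym]] := sY.
have x0 := card_language_gt0 (j * c) X0 Xm.
have y0 := card_language_gt0 (j * c) Y0 Ym.
have := YX j.
set y := #|` fset_set (language Y _)|%fset in y0 *.
set x := #|` fset_set (language X _)|%fset in x0 *.
rewrite -(ler_nat R) !natrM !natrX => yx.
have : ln (y%:R * D.+1%:R ^+ j) <= ln (2 * x%:R * D%:R ^+ j :> R).
  by rewrite ler_ln ?posrE ?mulr_gt0 ?exprn_gt0 ?ltr0n.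
rewrite !lnM ?posrE ?mulr_gt0 ?exprn_gt0 ?ltr0n // !lnXn ?ltr0n //.
rewrite -!(mulr_natl (ln _)) => lnyx.
have gE : g * c%:R = ln D.+1%:R - ln D%:R by rewrite divfK ?gt_eqF.
have j2 : ln 2 <= g / 2 * c%:R * j%:R by move: jg; rewrite ler_pdivrMr // mulrC.
change (ln (y%:R : R) / (j%:R * c%:R) <= ln x%:R / (j * c)%N%:R - g / 2).
move: jcR; rewrite natrM => jcR.
rewrite ler_pdivrMr // mulrBl divfK ?gt_eqF //.
have -> : g / 2 * (j%:R * c%:R) = j%:R * (g * c%:R) - g / 2 * c%:R * j%:R by field.
rewrite gE; lra.
Unshelve. all: by end_near.
Qed.

Theorem theorem4p2 (R : realType) (f : nat -> R) (hf : canonical_fun f)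
    (halpha : 0 < limiting_gradient f) :
  entropy_minimal R (bounded_density_shift f).
Proof.
have sX := bounded_density_subshift hf; split=> // Y sY Y0 [YX XY].
have [f1|f1] := ltP (f 1%N) 1.
  exfalso; apply: XY => x Xx.
  have zero z : bounded_density_shift f z -> z = fun=> 0%N.
    move=> Xz; apply/funext => i; have := Xz 1%N isT i; rewrite big_ord1 addr0 => zi.
    by have := le_lt_trans zi f1; rewrite ltrn1 => /eqP; rewrite subSS subn0.
  by have [y Yy] := Y0; rewrite (zero _ Xx) -(zero _ (YX _ Yy)).
have [N0 [N0p Xc]] := comb_mem hf f1 halpha.
have X0 : bounded_density_shift f !=set0 by exists (comb N0).
have [_ _ [m Xm]] := sX.
have [x Xx nYx] : exists2 x, bounded_density_shift f x & ~ Y x.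
  by apply: contrapT => h; apply: XY => x Xx; apply: contrapT => nYx; apply: h; exists x.
have [k [a Yw]] := missing_word sY nYx.
pose w (r : nat) := x (a + r%:Z).
have Xw : bounded_density_shift f (padded_word k w).
  apply: bounded_density_hereditary (bounded_density_translate a Xx) _ => i.
  by rewrite /padded_word /w; case: ifP => // /andP[i0 _]; rewrite gez0_abs // addrC.
have [c [D [c0 D0 YXgap]]] :=
  word_count_gap sX Xm N0p Xc Xw (fun r => Xm x Xx (a + r%:Z)) sY YX Yw.
exact: htop_lt YXgap.
Qed.
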